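(* Let $d\ge 1$ and let $X\overset{d}{=}\mu_1+R_1A_1U$ and $Y\overset{d}{=}\mu_2+R_2A_2U$ be elliptically distributed random vectors in $\mathbb{R}^d$, where $\mu_1,\mu_2\in\mathbb{R}^d$, $A_1,A_2$ are real $d\times d$ matrices, $U$ is uniformly distributed on the Euclidean unit sphere of $\mathbb{R}^d$, and $R_1,R_2$ are non-negative random variables, each independent of $U$. Put $C_i:=A_iA_i^{\top}$ for $i=1,2$. If $\mu_1\le\mu_2$ (componentwise), $R_1\preceq_{\mathrm{apl}}R_2$, and $$\forall \xi\in\Sigma^d\quad \xi^{\top}C_1\xi\le\xi^{\top}C_2\xi,$$ then $X\preceq_{\mathrm{apl}}Y$.
   Context: $\Sigma^d:=\{\xi\in[0,\infty)^d:\sum_{i=1}^d\xi_i=1\}$ is the unit simplex. Asymptotic portfolio loss order: for random vectors $X,Y$ in $\mathbb{R}^d$, $X\preceq_{\mathrm{apl}}Y$ means that for all $\xi\in\Sigma^d$, $\limsup_{t\to\infty}\frac{P\{\xi^{\top}X>t\}}{P\{\xi^{\top}Y\ge t\}}\le 1$, where $\frac00:=1$ (and $a/0=+\infty$ for $a>0$). For real random variables this is the case $d=1$, where $\Sigma^1=\{1\}$. *)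

(* Defs.v *)
From HB Require Import structures.
From mathcomp Require Import all_boot all_order all_algebra.
From mathcomp Require Import all_classical all_reals all_analysis.

Set Implicit Arguments.
Unset Strict Implicit.
Unset Printing Implicit Defensive.

Import Order.TTheory GRing.Theory Num.Theory.
Import numFieldNormedType.Exports.

Local Open Scope classical_set_scope.
Local Open Scope ring_scope.

(* Vectors of R^d are columns ['cV[R]_d]; real matrices carry the Borel
   sigma-algebra of their product topology. *)
HB.instance Definition _ (R : realType) (m n : nat) :=
  @isMeasurable.Build (sigma_display (@open 'M[R]_(m, n))) 'M[R]_(m, n)
    <<s @open 'M[R]_(m, n) >>
    (@sigma_algebra0 _ setT _) (@sigma_algebraC _ _)
    (@sigma_algebra_bigcup _ setT _).

Section vectors.
Context (R : realType) (d : nat).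
Implicit Types (x y xi : 'cV[R]_d).

Definition simplex : set 'cV[R]_d :=
  [set xi | (forall i, 0 <= xi i 0) /\ \sum_(i < d) xi i 0 = 1].

Definition dotp x y : R := (x^T *m y) 0 0.

(* The library norm [`|x|] on matrices is the maximum norm. *)
Definition enorm x : R := Num.sqrt (\sum_(i < d) x i 0 ^+ 2).

Definition unit_sphere : set 'cV[R]_d := [set x | enorm x = 1].

End vectors.

Section laws.
Context (R : realType).

Definition eq_in_dist (d1 d2 d' : measure_display)
    (T1 : measurableType d1) (T2 : measurableType d2) (S : measurableType d')
    (P1 : probability T1 R) (P2 : probability T2 R)
    (X1 : T1 -> S) (X2 : T2 -> S) : Prop :=
  forall B : set S, measurable B -> P1 (X1 @^-1` B) = P2 (X2 @^-1` B).

Definition independent_rv (d0 d1 d2 : measure_display)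
    (T : measurableType d0) (S1 : measurableType d1) (S2 : measurableType d2)
    (P : probability T R) (X1 : T -> S1) (X2 : T -> S2) : Prop :=
  forall (A : set S1) (B : set S2), measurable A -> measurable B ->
    (P ((X1 @^-1` A) `&` (X2 @^-1` B)) = P (X1 @^-1` A) * P (X2 @^-1` B))%E.

(* The uniform distribution on the unit sphere is the unique Borel probability
   measure on the sphere that is invariant under the orthogonal group O(d).
   O(d) rather than SO(d): for d = 1 the sphere is {-1, 1} and SO(1) is
   trivial. *)
Definition uniform_on_sphere (d0 : measure_display) (T : measurableType d0)
    (P : probability T R) (d : nat) (U : T -> 'cV[R]_d) : Prop :=
  P (U @^-1` @unit_sphere R d) = 1%E /\
  forall Q : 'M[R]_d, Q^T *m Q = 1%:M ->
    eq_in_dist P P (fun w => Q *m U w) U.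

(* The quotient a / b of nonnegative extended reals, for finite a and b, with
   0 / 0 = 1 and a / 0 = +oo for a > 0. *)
Definition apl_ratio (a b : \bar R) : \bar R :=
  if b == 0%E then (if a == 0%E then 1%E else +oo%E)
  else (fine a / fine b)%:E.

Definition apl (d1 d2 : measure_display)
    (T1 : measurableType d1) (T2 : measurableType d2)
    (P1 : probability T1 R) (P2 : probability T2 R) (d : nat)
    (X : T1 -> 'cV[R]_d) (Y : T2 -> 'cV[R]_d) : Prop :=
  forall xi : 'cV[R]_d, simplex xi ->
    (limf_esup (fun t : R => apl_ratio (P1 [set w | (t < dotp xi (X w))%R])
                                       (P2 [set w | (t <= dotp xi (Y w))%R]))
       (pinfty_nbhs R) <= 1)%E.

(* The case d = 1, with R identified with ['cV[R]_1]. *)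
Definition apl1 (d1 d2 : measure_display)
    (T1 : measurableType d1) (T2 : measurableType d2)
    (P1 : probability T1 R) (P2 : probability T2 R)
    (X : T1 -> R) (Y : T2 -> R) : Prop :=
  apl P1 P2 (fun w => (X w)%:M : 'cV[R]_1) (fun w => (Y w)%:M : 'cV[R]_1).

End laws.

(* Main.v *)
Require Import Defs.
From HB Require Import structures.
From mathcomp Require Import all_boot all_order all_algebra.
From mathcomp Require Import ring.
From mathcomp Require Import all_classical all_reals all_analysis.

Set Implicit Arguments.
Unset Strict Implicit.
Unset Printing Implicit Defensive.

Import Order.TTheory GRing.Theory Num.Theory.
Import numFieldNormedType.Exports.

Local Open Scope classical_set_scope.
Local Open Scope ring_scope.

(* In direction xi, the variable xi^T X is m1 + R1 <p1, U> with p1 = A1^T xi,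
   and similarly for Y, where |p1|^2 = xi^T C1 xi <= |p2|^2.  For t > m2 >= m1
   the event m1 + R1 <p1, U> > t implies R1 <k p1, U> > t - m2 = s, where
   k = |p2| / |p1|, and a reflection shows that V1 = <k p1, U> and V2 = <p2, U>
   have the same law, carried by ]-oo, |p2|].  Conditioning on the value v of V1
   or V2 compares P(R1 > s / v) with P(R2 >= s / v) for 0 < v <= |p2|; since
   s / v >= s / |p2|, the loss order of R1 and R2 gives the factor 1 + e
   uniformly in v. *)

(** * Inner product, Cauchy-Schwarz and reflections *)

Section dot_product.
Context (R : realType) (d : nat).
Implicit Types (x y p q : 'cV[R]_d) (A : 'M[R]_d).

Lemma dotpE x y : dotp x y = \sum_i x i 0 * y i 0.
Proof. by rewrite /dotp mxE; apply: eq_bigr => i _; rewrite mxE. Qed.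

Lemma dotpC x y : dotp x y = dotp y x.
Proof. by rewrite !dotpE; apply: eq_bigr => i _; rewrite mulrC. Qed.

Lemma dotpDr x y z : dotp x (y + z) = dotp x y + dotp x z.
Proof. by rewrite /dotp mulmxDr mxE. Qed.

Lemma dotpZr a x y : dotp x (a *: y) = a * dotp x y.
Proof. by rewrite /dotp -scalemxAr mxE. Qed.

Lemma dotpDl x y z : dotp (x + y) z = dotp x z + dotp y z.
Proof. by rewrite ![dotp _ z]dotpC dotpDr. Qed.

Lemma dotpZl a x y : dotp (a *: x) y = a * dotp x y.
Proof. by rewrite ![dotp _ y]dotpC dotpZr. Qed.

Lemma dotpNl x y : dotp (- x) y = - dotp x y.
Proof. by rewrite -scaleN1r dotpZl mulN1r. Qed.

Lemma dotp_mulmx A x y : dotp x (A *m y) = dotp (A^T *m x) y.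
Proof. by rewrite /dotp trmx_mul trmxK mulmxA. Qed.

Lemma dotp_ge0 x : 0 <= dotp x x.
Proof. by rewrite dotpE sumr_ge0// => i _; rewrite -expr2 sqr_ge0. Qed.

Lemma dotp_eq0 x : (dotp x x == 0) = (x == 0).
Proof.
apply/idP/eqP => [|->]; last by rewrite -(scale0r 0) dotpZl mul0r.
rewrite dotpE psumr_eq0; last by move=> i _; rewrite -expr2 sqr_ge0.
move=> /allP x0; apply/matrixP => i j; rewrite ord1 !mxE.
by have := x0 i (mem_index_enum _); rewrite -expr2 sqrf_eq0 => /eqP.
Qed.

Lemma unit_sphere_dotp x : unit_sphere x -> dotp x x = 1.
Proof.
rewrite /unit_sphere/= /enorm => x1.
rewrite -[RHS](expr1n _ 2) -x1 sqr_sqrtr ?dotpE//.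
by apply: sumr_ge0 => i _; exact: sqr_ge0.
Qed.

Lemma dotpNr x y : dotp x (- y) = - dotp x y.
Proof. by rewrite dotpC dotpNl dotpC. Qed.

(** Cauchy-Schwarz against a unit vector: with [dotp p p = a ^+ 2], the square norm of [a *: x - p]
    expands to [2 * a * (a - dotp p x)], which is nonnegative. *)
Lemma dotp_le_unit p x a : unit_sphere x -> 0 < a -> dotp p p = a ^+ 2 ->
  dotp p x <= a.
Proof.
move=> /unit_sphere_dotp x1 a0 pa; have := dotp_ge0 (a *: x - p).
rewrite !(dotpDl, dotpDr, dotpNl, dotpNr, dotpZl, dotpZr).
rewrite x1 pa [dotp x p]dotpC => h.
have : 0 <= (2 * a) * (a - dotp p x) by move: h; congr (_ <= _); ring.
by rewrite pmulr_rge0 ?mulr_gt0// subr_ge0.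
Qed.

(* Householder reflection along [p - q]. *)
Lemma orthogonal_map p q : dotp p p = dotp q q ->
  exists Q : 'M[R]_d, Q^T *m Q = 1%:M /\ Q^T *m p = q.
Proof.
move=> pq; have [->|npq] := eqVneq p q.
  by exists 1%:M; rewrite trmx1 mul1mx mul1mx.
set w := p - q; have w0 : dotp w w != 0 by rewrite dotp_eq0 subr_eq0.
(* The equal norms of [p] and [q] enter here: the component of [p] along [w] is [w / 2], so the
   reflection sends [p] to [p - w = q]. *)
have ww : dotp w w = 2 * dotp w p.
  rewrite /w !(dotpDl, dotpDr, dotpNl, dotpNr) pq [dotp q p]dotpC; ring.
have wwE (y : 'cV[R]_d) : w^T *m y = (dotp w y)%:M by rewrite [LHS]mx11_scalar.
set c := 2 / dotp w w; set N := w *m w^T; set Q := 1%:M - c *: N.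
have QT : Q^T = Q.
  by rewrite /Q linearB/= linearZ/= trmx_mul trmxK trmx1.
exists Q; rewrite QT; split.
  (* Since [N *m N] is [dotp w w] times [N], the factor 2 in [c] turns [N *m Q] into [N - 2 N];
     hence [Q] is an involution. *)
  have NQ : N *m Q = - N.
    rewrite mulmxBr mulmx1 -scalemxAr {3}/N -mulmxA [w^T *m _]mulmxA wwE.
    rewrite mul_scalar_mx -scalemxAr scalerA mulfVK// -/N.
    by rewrite scaler_nat mulr2n opprD addrA subrr sub0r.
  by rewrite {1}/Q mulmxBl mul1mx -scalemxAl NQ scalerN opprK subrK.
rewrite mulmxBl mul1mx -scalemxAl -mulmxA wwE mul_mx_scalar scalerA.
have -> : c * dotp w p = 1.
  by rewrite /c ww; move: w0; rewrite ww => w0; rewrite mulrAC mulfV.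
by rewrite scale1r opprB addrC subrK.
Qed.

End dot_product.

(** * Borel measurability of half-spaces and of the sphere *)

Section measurability.
Context (R : realType) (d : nat).

Lemma measurable_coord (i : 'I_d) :
  measurable_fun [set: 'cV[R]_d] (fun x : 'cV[R]_d => x i 0).
Proof.
apply: (measurability _ (measurable_realfun.RGenOInfty.measurableE R)).
move=> _ [_ [x ->] <-].
rewrite setTI; apply: sub_sigma_algebra.
apply: open_comp; last exact: interval_open.
by move=> y _; exact: coord_continuous.
Qed.

Lemma measurable_dotp (p : 'cV[R]_d) : measurable_fun [set: 'cV[R]_d] (dotp p).
Proof.
rewrite (_ : dotp p = fun x => \sum_i p i 0 * x i 0); last first.
  by apply/funext => x; rewrite dotpE.
apply: measurable_sum => i; apply: measurable_realfun.measurable_funM => //.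
exact: measurable_coord.
Qed.

Lemma measurable_dotp_gt (p : 'cV[R]_d) (t : R) :
  measurable [set x | t < dotp p x].
Proof.
rewrite -[X in measurable X]setTI.
rewrite -[[set _ | _]]/(dotp p @^-1` [set v | t < v]).
by rewrite -set_itvoy; exact: measurable_dotp.
Qed.

Lemma measurable_dotp_ge (p : 'cV[R]_d) (t : R) :
  measurable [set x | t <= dotp p x].
Proof.
rewrite -[X in measurable X]setTI.
rewrite -[[set _ | _]]/(dotp p @^-1` [set v | t <= v]).
by rewrite -set_itvcy; exact: measurable_dotp.
Qed.

Lemma measurable_unit_sphere : measurable (@unit_sphere R d).
Proof.
rewrite -[X in measurable X]setTI.
have m : measurable_fun setT (fun x : 'cV[R]_d => dotp x x).
  under eq_fun do rewrite dotpE.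
  by apply: measurable_sum => i; apply: measurable_realfun.measurable_funM;
    exact: measurable_coord.
rewrite (_ : @unit_sphere R d = (fun x : 'cV[R]_d => dotp x x) @^-1` [set 1]).
  exact: m.
apply/seteqP; split => x /=; first exact: unit_sphere_dotp.
rewrite /unit_sphere/= /enorm dotpE => x1.
by under eq_bigr do rewrite expr2; rewrite x1 sqrtr1.
Qed.

End measurability.

(** * Conditioning on an independent variable *)

Section independence.
Context (R : realType) (d0 d1 d2 : measure_display) (T : measurableType d0).
Context (S1 : measurableType d1) (S2 : measurableType d2).

(** By independence the law of [(V, X)] agrees with the product of the marginal laws on rectangles,
    hence everywhere; the product measure of [B] is the integral of its sections. *)
Lemma independent_joint_prob (P : probability T R) (X : {RV P >-> S1})
    (V : {RV P >-> S2}) (B : set (S2 * S1)) :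
  independent_rv P X V -> measurable B ->
  (P [set w | B (V w, X w)] =
   \int[distribution P V]_v distribution P X (xsection B v))%E.
Proof.
move=> XV mB.
have mVX : measurable_fun [set: T] (fun w => (V w, X w)).
  exact: measurable_fun_pair.
pose J : {RV P >-> _} := mfun_Sub (mem_set mVX).
rewrite -[LHS]/(distribution P J B).
rewrite -(@product_measure_unique _ _ _ _ _ (distribution P V)
  (distribution P X) (distribution P J))// => A C mA mC.
by rewrite /distribution/= /pushforward muleC -XV// setIC.
Qed.

End independence.

(** * The loss order as eventual inequalities without quotients *)

Section limsup_ratio.
Context (R : realType).
Local Open Scope ereal_scope.

(** Cross-multiplication survives [b = 0] because [c] is at least 1: for [a = 0] the value 0/0 = 1
    is at most [c], and for [a > 0] both sides fail. *)
Lemma apl_ratio_le (a b : \bar R) (c : R) :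
  0 <= a -> a \is a fin_num -> 0 <= b -> b \is a fin_num -> (1 <= c)%R ->
  (apl_ratio a b <= c%:E) = (a <= c%:E * b).
Proof.
case: a => [a||]// a0 _; case: b => [b||]// b0 _ c1.
rewrite /apl_ratio !eqe -EFinM; move: a0 b0; rewrite !lee_fin => a0 b0.
have [->|bn0] := eqVneq b 0%R.
  rewrite mulr0; have [->|an0] := eqVneq a 0%R; first by rewrite lexx.
  by rewrite leye_eq/=; apply/esym/negbTE; rewrite -ltNge lt_neqAle eq_sym an0.
by rewrite lee_fin/= ler_pdivrMr// lt_neqAle eq_sym bn0.
Qed.

(** The limsup is an infimum, over neighbourhoods of infinity, of suprema: an infimum below [1 + e]
    selects a neighbourhood, and conversely the set where the bound holds is one. *)
Lemma limf_esup_apl_ratio_le1P (f g : R -> \bar R) :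
  (forall t, 0 <= f t) -> (forall t, f t \is a fin_num) ->
  (forall t, 0 <= g t) -> (forall t, g t \is a fin_num) ->
  limf_esup (fun t => apl_ratio (f t) (g t)) (pinfty_nbhs R) <= 1 <->
  forall e : R, (0 < e)%R ->
    \forall t \near +oo%R, f t <= (1 + e)%:E * g t.
Proof.
move=> f0 ffin g0 gfin.
have rle t (e : R) : (0 < e)%R ->
    (apl_ratio (f t) (g t) <= (1 + e)%:E) = (f t <= (1 + e)%:E * g t).
  by move=> e0; rewrite apl_ratio_le// lerDl ltW.
split=> [h e e0|h].
- have /ereal_inf_lt[_ [A nA <-]] :
      limf_esup (fun t => apl_ratio (f t) (g t)) (pinfty_nbhs R) < (1 + e)%:E.
    by apply: (le_lt_trans h); rewrite lte_fin ltrDl.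
  move=> Ae; apply: filterS nA => t At; rewrite -rle//.
  by apply: le_trans (ltW Ae); apply: ereal_sup_ubound; exists t.
- apply/lee_addgt0Pr => e e0; rewrite -EFinD.
  apply: ereal_inf_le; eexists.
    by exists [set t | f t <= (1 + e)%:E * g t] => //; exact: h.
  by apply: ge_ereal_sup => _ [t ft <-]; rewrite rle.
Qed.

End limsup_ratio.

(** * Tails of a product of independent variables *)

Section scale_mixture.
Context (R : realType) (d0 : measure_display) (T : measurableType d0).
Context (P : probability T R).

Lemma measurable_RV_preimage d (S : measurableType d) (X : {RV P >-> S}) B :
  measurable B -> measurable (X @^-1` B).
Proof.
by move=> mB; rewrite -[X in measurable X]setTI; exact: measurable_funP.
Qed.

Lemma measurable_RV_gt (X : {RV P >-> R}) t : measurable [set w | t < X w].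
Proof.
rewrite -[[set _ | _]]/(X @^-1` [set v | t < v]) -set_itvoy.
exact: measurable_RV_preimage.
Qed.

Lemma measurable_RV_ge (X : {RV P >-> R}) t : measurable [set w | t <= X w].
Proof.
rewrite -[[set _ | _]]/(X @^-1` [set v | t <= v]) -set_itvcy.
exact: measurable_RV_preimage.
Qed.

Lemma measurable_RV_le (X : {RV P >-> R}) t : measurable [set w | X w <= t].
Proof.
rewrite -[[set _ | _]]/(X @^-1` [set v | v <= t]) -set_itvNyc.
exact: measurable_RV_preimage.
Qed.

Lemma measurable_scaled_gt (s : R) :
  measurable [set u : R * R | s < u.2 * u.1].
Proof.
rewrite -[X in measurable X]setTI.
apply: (@measurable_realfun.measurable_fun_ltr _ _ _ setT (cst s)
  (fun u : R * R => u.2 * u.1)) (measurableT) [set true] _ => //.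
exact: measurable_realfun.measurable_funM.
Qed.

Lemma measurable_scaled_ge (s : R) :
  measurable [set u : R * R | s <= u.2 * u.1].
Proof.
rewrite -[X in measurable X]setTI.
apply: (@measurable_realfun.measurable_fun_ler _ _ _ setT (cst s)
  (fun u : R * R => u.2 * u.1)) (measurableT) [set true] _ => //.
exact: measurable_realfun.measurable_funM.
Qed.

(** Given the value [v] of the second factor, the tails are those of [X1] and [X2] at [s / v]. As
    [v] is almost surely at most [a], only levels from [s / a] on occur, so a single [c] serves for
    all [v]. *)
Lemma tail_product_le (X1 X2 V1 V2 : {RV P >-> R}) (a c s : R) :
  (forall w, 0 <= X1 w) -> independent_rv P X1 V1 -> independent_rv P X2 V2 ->
  eq_in_dist P P V1 V2 -> P [set w | V1 w <= a] = 1%E ->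
  0 < a -> 0 < s -> 0 <= c ->
  (forall t, s / a <= t ->
    (P [set w | (t < X1 w)%R] <= c%:E * P [set w | (t <= X2 w)%R])%E) ->
  (P [set w | (s < X1 w * V1 w)%R] <=
   c%:E * P [set w | (s <= X2 w * V2 w)%R])%E.
Proof.
move=> X1_ge0 XV1 XV2 V12 V1a a0 s0 c0 tailX.
have m1 := measurable_fun_xsection (distribution P X1) (measurable_scaled_gt s).
have m2 := measurable_fun_xsection (distribution P X2) (measurable_scaled_ge s).
rewrite (independent_joint_prob XV1 (measurable_scaled_gt s)).
rewrite (independent_joint_prob XV2 (measurable_scaled_ge s)).
(* Both integrals are now taken against the law of [V1], so that the integrands can be compared
   pointwise. *)
rewrite -(@eq_measure_integral _ _ _ _ (distribution P V2)
  (distribution P V1)); last by move=> A mA _; exact: V12.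
rewrite -ge0_integralZl//.
apply: ae_ge0_le_integral => //.
- by move=> v _; rewrite mule_ge0.
- exact: measurable_funeM.
have sectE (B : set (R * R)) (X : {RV P >-> R}) v :
    distribution P X (xsection B v) = P [set w | B (v, X w)].
  rewrite /distribution/= /pushforward; congr (P _).
  by apply/seteqP; split => w /=; rewrite /xsection/= inE.
(* The comparison may fail only for [v > a], a null set for the law of [V1]. *)
exists [set v | a < v]; split.
- by rewrite -set_itvoy.
- transitivity (P (~` [set w | V1 w <= a])).
    by congr (P _); apply/seteqP; split => w /=; rewrite ltNge => /negP.
  by rewrite probability_setC ?V1a ?subee//; exact: measurable_RV_le.
move=> v /= /not_implyP[_]; apply: contra_notP => /negP; rewrite -leNgt => va.
rewrite !sectE/=.
(* For [v <= 0] the left event is empty, as [X1] is nonnegative and [s] positive. *)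
have [v0|v0] := leP v 0.
  rewrite (_ : [set w | _] = set0).
    by rewrite measure0 mule_ge0// lee_fin.
  rewrite -subset0 => w /= /(lt_trans s0).
  by rewrite ltNge mulr_ge0_le0.
rewrite (_ : [set w | s < X1 w * v] = [set w | s / v < X1 w]); last first.
  by apply/seteqP; split => w /=; rewrite ltr_pdivrMr.
rewrite (_ : [set w | s <= X2 w * v] = [set w | s / v <= X2 w]); last first.
  by apply/seteqP; split => w /=; rewrite ler_pdivrMr.
by apply: tailX; rewrite ler_pM2l// lef_pV2.
Qed.

End scale_mixture.

(** * Projections of the uniform law and the order of the radii *)

Section random_vectors.
Context (R : realType) (d0 : measure_display) (T : measurableType d0).
Context (P : probability T R).

(** With [Q] orthogonal and [Q^T *m p = q], the product [dotp p (Q *m U)] equals [dotp q U], while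
    [Q *m U] has the law of [U]. *)
Lemma uniform_dotp_law (d : nat) (U : {RV P >-> 'cV[R]_d}) (p q : 'cV[R]_d) :
  uniform_on_sphere P U -> dotp p p = dotp q q ->
  eq_in_dist P P (fun w => dotp p (U w)) (fun w => dotp q (U w)).
Proof.
move=> [_ Uinv] /orthogonal_map[Q [QQ Qp]] B mB.
have mpB : measurable (dotp p @^-1` B).
  by rewrite -[X in measurable X]setTI; exact: measurable_dotp.
rewrite -[LHS](Uinv Q QQ _ mpB); congr (P _); apply/seteqP.
by split=> w /=; rewrite dotp_mulmx Qp.
Qed.

Lemma apl1P (R1 R2 : {RV P >-> R}) : apl1 P P R1 R2 ->
  forall e : R, 0 < e -> \forall t \near +oo,
    (P [set w | (t < R1 w)%R] <= (1 + e)%:E * P [set w | (t <= R2 w)%R])%E.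
Proof.
have s1 : simplex (1%:M : 'cV[R]_1).
  split=> [i|]; first by rewrite ord1 mxE ler01.
  by rewrite big_ord1 mxE.
move=> /(_ 1%:M s1).
under eq_fun => t.
  under [X in P X]eq_set => w do
    rewrite dotpE big_ord1 !mxE mul1r mulr1n.
  under [X in apl_ratio _ (P X)]eq_set => w do
    rewrite dotpE big_ord1 !mxE mul1r mulr1n.
  over.
move/limf_esup_apl_ratio_le1P; apply => t //; apply: fin_num_measure.
  exact: measurable_RV_gt.
exact: measurable_RV_ge.
Qed.

End random_vectors.

(** * Comparison of the two tails in a fixed direction of the simplex *)

Theorem theorem2p7 (R : realType) (d : nat) (d_ge1 : (1 <= d)%N)
  (dX dY dO : measure_display)
  (TX : measurableType dX) (PX : probability TX R)
  (TY : measurableType dY) (PY : probability TY R)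
  (Omega : measurableType dO) (P : probability Omega R)
  (X : {RV PX >-> 'cV[R]_d}) (Y : {RV PY >-> 'cV[R]_d})
  (mu1 mu2 : 'cV[R]_d) (A1 A2 : 'M[R]_d)
  (U : {RV P >-> 'cV[R]_d}) (R1 R2 : {RV P >-> R})
  (U_uniform : uniform_on_sphere P U)
  (R1_ge0 : forall w, 0 <= R1 w) (R2_ge0 : forall w, 0 <= R2 w)
  (R1_indep_U : independent_rv P R1 U) (R2_indep_U : independent_rv P R2 U)
  (X_law : eq_in_dist PX P X (fun w => mu1 + R1 w *: (A1 *m U w)))
  (Y_law : eq_in_dist PY P Y (fun w => mu2 + R2 w *: (A2 *m U w)))
  (mu_le : forall i, mu1 i 0 <= mu2 i 0)
  (R_apl : apl1 P P R1 R2)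
  (C_le : forall xi : 'cV[R]_d, simplex xi ->
    (xi^T *m (A1 *m A1^T) *m xi) 0 0 <= (xi^T *m (A2 *m A2^T) *m xi) 0 0) :
  apl PX PY X Y.
Proof.
move=> xi xis; have [xi0 _] := xis.
have [Usphere _] := U_uniform.
set p1 := A1^T *m xi; set p2 := A2^T *m xi.
set m1 := dotp xi mu1; set m2 := dotp xi mu2.
have m12 : m1 <= m2.
  by rewrite /m1 /m2 !dotpE ler_sum// => i _; rewrite ler_wpM2l.
have p12 : dotp p1 p1 <= dotp p2 p2.
  by move: (C_le _ xis); rewrite /dotp !trmx_mul !trmxK !mulmxA.
apply/limf_esup_apl_ratio_le1P => //.
- move=> t; apply: fin_num_measure.
  exact: (measurable_RV_preimage X (measurable_dotp_gt xi t)).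
- move=> t; apply: fin_num_measure.
  exact: (measurable_RV_preimage Y (measurable_dotp_ge xi t)).
have XE t : PX [set w | t < dotp xi (X w)] =
            P [set w | t < m1 + R1 w * dotp p1 (U w)].
  rewrite [LHS](X_law _ (measurable_dotp_gt xi t)); congr (P _).
  by apply/seteqP; split=> w /=; rewrite dotpDr dotpZr dotp_mulmx.
have YE t : PY [set w | t <= dotp xi (Y w)] =
            P [set w | t <= m2 + R2 w * dotp p2 (U w)].
  rewrite [LHS](Y_law _ (measurable_dotp_ge xi t)); congr (P _).
  by apply/seteqP; split=> w /=; rewrite dotpDr dotpZr dotp_mulmx.
move=> e e0; have e1 : 0 <= 1 + e by rewrite addr_ge0// ltW.
(* If [p1 = 0], the projection of [X] has the law of the constant [m1], whose tail vanishes once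
   [t >= m1]; otherwise division by the norm of [p1] is possible. *)
have [p1_0|p1_neq0] := eqVneq (dotp p1 p1) 0.
  near=> t; rewrite XE YE (_ : [set w | t < _] = set0); last first.
    rewrite -subset0 => w /=; apply/negP; rewrite -leNgt.
    have /eqP -> : p1 == 0 by rewrite -dotp_eq0 p1_0.
    rewrite -(scale0r 0) dotpZl mul0r mulr0 addr0.
    by near: t; exact/nbhs_pinfty_ge/num_real.
  by rewrite measure0 mule_ge0.
have p1_gt0 : 0 < dotp p1 p1 by rewrite lt_neqAle eq_sym p1_neq0 dotp_ge0.
have p2_gt0 : 0 < dotp p2 p2 := lt_le_trans p1_gt0 p12.
set a := Num.sqrt (dotp p2 p2); have a0 : 0 < a by rewrite sqrtr_gt0.
set k := Num.sqrt (dotp p2 p2 / dotp p1 p1).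
have k1 : 1 <= k by rewrite -sqrtr1 ler_wsqrtr// ler_pdivlMr// mul1r.
have kp : dotp (k *: p1) (k *: p1) = dotp p2 p2.
  rewrite dotpZl dotpZr mulrA -expr2 sqr_sqrtr ?mulfVK//.
  by rewrite divr_ge0// dotp_ge0.
pose V (p : 'cV[R]_d) : {RV P >-> R} := mfun_Sub (mem_set
  (measurableT_comp (@measurable_dotp R d p) (measurable_funPT U))).
have indepV (S : {RV P >-> R}) p : independent_rv P S U ->
    independent_rv P S (V p).
  move=> SU A B mA mB; apply: (SU A (dotp p @^-1` B) mA).
  by rewrite -[X in measurable X]setTI; exact: measurable_dotp.
(* [U] lies on the sphere almost surely and [k *: p1] has norm [a], so Cauchy-Schwarz applies. *)
have Va : P [set w | V (k *: p1) w <= a] = 1%E.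
  apply/eqP; rewrite eq_le probability_le1/=; last first.
    exact: (measurable_RV_le (V (k *: p1))).
  rewrite -Usphere le_measure ?inE//.
  - exact: (measurable_RV_preimage U (@measurable_unit_sphere R d)).
  - exact: (measurable_RV_le (V (k *: p1))).
  - move=> w Uw /=; apply: dotp_le_unit => //.
    by rewrite kp sqr_sqrtr// ltW.
have [M [_ tailR]] := apl1P R_apl e0.
near=> t.
have tm2 : m2 < t by near: t; exact/nbhs_pinfty_gt/num_real.
rewrite XE YE.
rewrite (_ : [set w | t <= _] = [set w | t - m2 <= R2 w * V p2 w]); last first.
  by apply/seteqP; split=> w /=; rewrite lerBlDl.
apply: le_trans (@tail_product_le _ _ _ P R1 R2 (V (k *: p1)) (V p2) a (1 + e)
  (t - m2) _ _ _ _ _ _ _ _ _) => //; first last.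
(* Taking [t > m2 + M * a] puts [(t - m2) / a], and every larger level, beyond the threshold [M]. *)
- move=> u tu; apply: tailR; apply: lt_le_trans tu.
  rewrite ltr_pdivlMr// ltrBrDl; near: t; exact/nbhs_pinfty_gt/num_real.
- by rewrite subr_gt0.
- exact: uniform_dotp_law.
- exact: indepV.
- exact: indepV.
have mRV p : measurable_fun [set: Omega] (fun w => R1 w * V p w).
  exact: measurable_realfun.measurable_funM.
apply: le_measure; rewrite ?inE.
- have mZ := measurable_realfun.measurable_funD (measurable_cst m1) (mRV p1).
  exact: (measurable_RV_gt (mfun_Sub (mem_set mZ))).
- exact: (measurable_RV_gt (mfun_Sub (mem_set (mRV (k *: p1))))).
move=> w /=; rewrite dotpZl -ltrBlDl mulrCA => h.
have tm : t - m2 <= t - m1 by rewrite lerB.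
(* On this event the product exceeds [t - m1], which is positive since [t > m2 >= m1]; its sign is
   what makes multiplication by [k >= 1] enlarge it. *)
have z0 : 0 <= R1 w * dotp p1 (U w).
  by rewrite (le_trans _ (ltW h))// subr_ge0 (le_trans m12)// ltW.
apply: (le_lt_trans tm); apply: (lt_le_trans h).
by rewrite ler_peMl.
Unshelve. all: by end_near.
Qed.
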